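(* For $r\ge 2$ define $$\rho_r=\tfrac12(uu^* )^{\otimes r}+\tfrac12(\overline u\,\overline u^* )^{\otimes r},\qquad u=\tfrac1{\sqrt2}\begin{pmatrix}1\\ \mathbf i\end{pmatrix}\in\mathbb C^2,$$ where $\mathbf i$ is the imaginary unit; the matrices $\rho_r$ are real, $r$-doubly symmetric, positive semidefinite, with trace $1$. There do not exist elements $\tau_r\in\mathcal C_2(\mathbb R^2)$ ($r\ge2$) for which $\lim_{r\to\infty}\|\mathrm{Tr}_{r-2}(\rho_r)-\tau_r\|_1=0$.
   Context: Matrices $M$ here are indexed by $[n]^r\times[n]^r$ with $n=2$, $[n]=\{1,\dots,n\}$. A real symmetric matrix $M$ is $r$-doubly symmetric if $\Pi_rM\Pi_r=M$, where $\Pi_r$ is the orthogonal projection of $(\mathbb C^n)^{\otimes r}$ onto the subspace of symmetric $r$-tensors. The partial trace $\mathrm{Tr}_{r-d}(M)$ is the matrix indexed by $[n]^d\times[n]^d$ with entries $(\mathrm{Tr}_{r-d}(M))_{\underline i,\underline j}=\sum_{\underline k\in[n]^{r-d}}M_{\underline i\,\underline k,\underline j\,\underline k}$ (concatenated indices). $\mathcal C_2(\mathbb R^2)=\mathrm{conv}\{v^{\otimes 2}(v^{\otimes 2})^T:v\in\mathbb R^2,\|v\|_2=1\}$. $\|\cdot\|_1$ is the Schatten 1-norm (sum of the absolute values of the eigenvalues of a Hermitian matrix). *)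

(* Defs.v *)
From HB Require Import structures.
From mathcomp Require Import all_boot all_order all_algebra all_fingroup.
From mathcomp Require Import spectral sesquilinear.
From mathcomp Require Import all_classical all_reals all_analysis.
From mathcomp Require Import complex.

Set Implicit Arguments.
Unset Strict Implicit.
Unset Printing Implicit Defensive.

Import Order.TTheory GRing.Theory Num.Theory.
Import numFieldNormedType.Exports.

Local Open Scope classical_set_scope.
Local Open Scope ring_scope.
Local Open Scope sesquilinear_scope.

(* The index set [n]^r is the type of r-tuples over 'I_n; its elements are
   numbered by enum_rank and recovered by enum_val. *)
Notation tdim n r := #|{: r.-tuple 'I_n}|.

Definition tensv (K : comNzRingType) (n r : nat) (v : 'cV[K]_n) :
    'cV[K]_(tdim n r) :=
  \col_a \prod_(k < r) v (tnth (enum_val a) k) 0.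

Definition tensmx (K : comNzRingType) (n r : nat) (A : 'M[K]_n) :
    'M[K]_(tdim n r) :=
  \matrix_(a, b)
    \prod_(k < r) A (tnth (enum_val a) k) (tnth (enum_val b) k).

(* For r = d + e this is Tr_{r-d}: the last e = r - d factors are traced
   out. *)
Definition partial_trace (K : nzRingType) (n d e : nat)
    (M : 'M[K]_(tdim n (d + e))) : 'M[K]_(tdim n d) :=
  \matrix_(a, b) \sum_(k : e.-tuple 'I_n)
    M (enum_rank (cat_tuple (enum_val a) k))
      (enum_rank (cat_tuple (enum_val b) k)).

(* Permutation of the tensor factors, as a matrix acting on row vectors. *)
Definition factor_perm (K : nzRingType) (n r : nat) (s : 'S_r) :
    'M[K]_(tdim n r) :=
  \matrix_(a, b)
    (enum_val b == [tuple tnth (enum_val a) (s k) | k < r])%:R.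

(* The row space of this matrix is the space of symmetric r-tensors, i.e. of
   the tensors fixed by all permutations of the factors. *)
Definition sym_tensors (C : numClosedFieldType) (n r : nat) :
    'M[C]_(tdim n r) :=
  (\bigcap_(s : 'S_r) eigenspace (factor_perm C n s) 1)%MS.

Definition sym_proj (C : numClosedFieldType) (n r : nat) : 'M[C]_(tdim n r) :=
  proj_ortho (sym_tensors C n r).

Definition doubly_symmetric (C : numClosedFieldType) (n r : nat)
    (M : 'M[C]_(tdim n r)) : Prop :=
  [/\ M \is a realmx, M \is symmetricmx
    & sym_proj C n r *m M *m sym_proj C n r = M].

Definition psdmx (C : numClosedFieldType) (m : nat) (M : 'M[C]_m) : Prop :=
  M \is hermsymmx /\ forall v : 'cV[C]_m, 0 <= (v ^t* *m M *m v) 0 0.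

(* Schatten 1-norm of a Hermitian matrix: spectral_diag lists the eigenvalues
   with multiplicity as soon as A is normal. *)
Definition schatten1 (R : realType) (m : nat) (A : 'M[R[i]]_m) : R :=
  \sum_(k < m) ComplexField.Normc.normc (spectral_diag A 0 k).

Definition convex_hull (R : numDomainType) (E : lmodType R) (A : set E) :
    set E :=
  smallest (@convex_set R E) A.

Definition norm2 (R : realType) (n : nat) (v : 'cV[R]_n) : R :=
  Num.sqrt (\sum_(i < n) v i 0 ^+ 2).

(* The set C_r(R^n). *)
Definition Cset (R : realType) (n r : nat) : set 'M[R]_(tdim n r) :=
  convex_hull
    [set tensv r v *m (tensv r v)^T | v in [set v : 'cV[R]_n | norm2 v = 1]].

Arguments Cset : clear implicits.

Definition uvec (R : realType) : 'cV[R[i]]_2 :=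
  (real_complex R (Num.sqrt 2))^-1 *: \col_(k < 2) (if k == 0 then 1 else 'i%C).

Definition rho (R : realType) (r : nat) : 'M[R[i]]_(tdim 2 r) :=
  let u := uvec R in
  let ubar := map_mx Num.conj u in
  2^-1 *: tensmx r (u *m u ^t*) + 2^-1 *: tensmx r (ubar *m ubar ^t*).

(* Main.v *)
Require Import Defs.
From mathcomp Require Import all_boot all_order all_algebra all_fingroup.
From mathcomp Require Import spectral sesquilinear.
From mathcomp Require Import all_classical all_reals all_analysis.
From mathcomp Require Import complex.
From mathcomp Require Import ring lra.
Import Order.TTheory GRing.Theory Num.Theory.
Import numFieldNormedType.Exports.
Local Open Scope classical_set_scope.
Local Open Scope ring_scope.
Local Open Scope sesquilinear_scope.

(** Write A = u u^*.  This Hermitian matrix has trace 1, so tracing out a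
    factor of a tensor power of A deletes that factor; the same holds for the
    conjugate of A.  Hence Tr_{r-2}(rho_r) = rho_2 for all r
    ([partial_trace_rho]), and the sequence to be approximated by elements of
    C_2(R^2) is constant.

    An entry (v_i v_j)(v_k v_l) of the matrix of v^{⊗2} (v^{⊗2})^T does not
    depend on how the four indices are split between rows and columns.  In
    particular the entries at (01, 10) and (00, 11) agree, and as this is a
    linear condition it holds on the whole convex hull ([Cset_sym_gap]).  The
    same two entries of rho_2 are 1/4 and -1/4 ([gap_rho]).
    Conceptually, rho_2 = (I ⊗ I + Y ⊗ Y) / 4 for the Pauli matrix Y, and
    v^T Y v = 0 for every real v makes the elements of C_2(R^2) orthogonal to
    Y ⊗ Y.

    An entry of a normal matrix is bounded by its Schatten 1-norm
    ([spectral_entry_le]), so rho_2 stays at distance at least 1/4 from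
    C_2(R^2) ([rho2_far]).

    For the properties of rho_r itself, the tensor power of a rank one matrix
    is the rank one matrix of the tensor power ([tensmx_outer]), so
    2 rho_r = x x^* + y y^* with x and y the r-th tensor powers of u and of
    its conjugate.  Such a sum is positive semidefinite, it is fixed by the
    symmetric projection because x and y are symmetric tensors
    ([tensv_sym]), and it is real because y is the conjugate of x. *)

(** * Tensor powers *)

Lemma sum_tuple_prod (K : comNzRingType) (I : finType) (r : nat) (F : I -> K) :
  \sum_(t : r.-tuple I) \prod_(k < r) F (tnth t k) = (\sum_i F i) ^+ r.
Proof.
rewrite -[in RHS](card_ord r) -prodr_const bigA_distr_bigA /=.
rewrite (reindex (@tuple_of_finfun I r)) /=; last first.
  by apply: onW_bij; exists (@finfun_of_tuple I r);
    [exact: tuple_of_finfunK | exact: finfun_of_tupleK].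
by apply: eq_bigr => f _; apply: eq_bigr => k _; rewrite tnth_mktuple.
Qed.

Lemma sum_tdim (K : nzRingType) (n r : nat) (F : 'I_(tdim n r) -> K) :
  \sum_a F a = \sum_(t : r.-tuple 'I_n) F (enum_rank t).
Proof.
rewrite (reindex (@enum_rank {: r.-tuple 'I_n})) //=.
exact/onW_bij/enum_rank_bij.
Qed.

Lemma mxtrace_tensmx (K : comNzRingType) (n r : nat) (A : 'M[K]_n) :
  \tr (tensmx r A) = (\tr A) ^+ r.
Proof.
rewrite /mxtrace sum_tdim -sum_tuple_prod.
by apply: eq_bigr => t _; rewrite mxE enum_rankK.
Qed.

Lemma mxtrace_lin (K : nzRingType) (m : nat) (a b : K) (M N : 'M[K]_m) :
  \tr (a *: M + b *: N) = a * \tr M + b * \tr N.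
Proof. by rewrite mxtraceD !mxtraceZ. Qed.

Lemma partial_trace_tensmx (K : comNzRingType) (n d e : nat) (A : 'M[K]_n) :
  partial_trace (tensmx (d + e) A) = (\tr A) ^+ e *: tensmx d A.
Proof.
apply/matrixP => a b; rewrite !mxE -sum_tuple_prod mulr_suml.
apply: eq_bigr => k _; rewrite mxE !enum_rankK big_split_ord /= mulrC.
by congr (_ * _); apply: eq_bigr => i _; rewrite !(tnth_lshift, tnth_rshift).
Qed.

Lemma partial_trace_lin (K : comNzRingType) (n d e : nat) (a b : K)
    (M N : 'M[K]_(tdim n (d + e))) :
  partial_trace (a *: M + b *: N) = a *: partial_trace M + b *: partial_trace N.
Proof.
apply/matrixP => i j; rewrite !mxE !mulr_sumr -big_split /=.
by apply: eq_bigr => k _; rewrite !mxE.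
Qed.

Lemma tensmx_rank1 (K : comNzRingType) (n r : nat) (v : 'cV[K]_n)
    (w : 'rV[K]_n) :
  tensmx r (v *m w) = tensv r v *m (tensv r w^T)^T.
Proof.
apply/matrixP => a b; rewrite !mxE big_ord1 !mxE -big_split /=.
by apply: eq_bigr => k _; rewrite !mxE big_ord1.
Qed.

Lemma map_tensv (K L : comNzRingType) (f : {rmorphism K -> L}) (n r : nat)
    (v : 'cV[K]_n) :
  map_mx f (tensv r v) = tensv r (map_mx f v).
Proof.
apply/matrixP => a b; rewrite !mxE rmorph_prod.
by apply: eq_bigr => k _; rewrite mxE.
Qed.

Lemma tensmx_outer (C : numClosedFieldType) (n r : nat) (v : 'cV[C]_n) :
  tensmx r (v *m v ^t*) = tensv r v *m (tensv r v) ^t*.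
Proof.
by rewrite tensmx_rank1 -map_trmx trmxK -map_tensv map_trmx.
Qed.

(** * Symmetric tensors and the orthogonal projection on them *)

Lemma tensv_factor_perm (K : comNzRingType) (n r : nat) (s : 'S_r)
    (v : 'cV[K]_n) :
  (tensv r v)^T *m factor_perm K n s = (tensv r v)^T.
Proof.
apply/rowP => b; rewrite !mxE sum_tdim.
(* The only index with a nonzero coefficient in column b is b permuted by the
   inverse of s, and v^{⊗r} takes the same value there as at b. *)
pose t0 : r.-tuple 'I_n := [tuple tnth (enum_val b) ((s^-1)%g k) | k < r].
rewrite (bigD1 t0) //= big1 => [|t tN].
  rewrite addr0 !mxE !enum_rankK (_ : _ == _ = true) ?mulr1; last first.
    by apply/eqP/eq_from_tnth => k; rewrite !tnth_mktuple permK.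
  rewrite (reindex_inj (@perm_inj _ s)) /=.
  by apply: eq_bigr => k _; rewrite tnth_mktuple permK.
rewrite !mxE !enum_rankK; case: eqP => [bE|_]; last by rewrite mulr0.
case/eqP: tN; apply: eq_from_tnth => k.
by rewrite tnth_mktuple bE tnth_mktuple permKV.
Qed.

Lemma tensv_sym (C : numClosedFieldType) (n r : nat) (v : 'cV[C]_n) :
  ((tensv r v)^T <= sym_tensors C n r)%MS.
Proof.
apply/sub_bigcapmxP => s _; apply/eigenspaceP.
by rewrite tensv_factor_perm scale1r.
Qed.

(** Since 1 - P maps into the orthogonal complement of the range of P, one has
    (1 - P) P^* = 0, so P^* = P P^*, and the right-hand side is Hermitian. *)
Lemma proj_ortho_herm (C : numClosedFieldType) (m n : nat) (U : 'M[C]_(m, n)) :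
  (proj_ortho U) ^t* = proj_ortho U.
Proof.
set P := proj_ortho U.
have PE : P ^t* = P *m P ^t*.
  apply/eqP; rewrite -subr_eq0 -{1}(mul1mx (P ^t*)) -mulmxBl -orthomx1E.
  pose Uperp := orthomx Num.conj (mx_of_hermitian (hermitian1mx _)) U.
  apply: (@submx_trans _ _ _ _ _ _ Uperp).
    by rewrite -[P]mul1mx proj_ortho_compl_sub.
  by rewrite submx_ortho proj_orthoE.
clearbody P.
have PP : (P *m P ^t*) ^t* = P *m P ^t*.
  by rewrite trmx_mul map_mxM; congr (_ *m _); exact: trmxCK.
by rewrite {1}PE -PP -PE trmxCK.
Qed.

(** * Hermitian matrices *)

(** In A = P^* D P with P unitary, every entry of P has modulus at most 1, so
    each eigenvalue contributes at most its modulus to an entry of A. *)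
Lemma spectral_entry_le (R : realType) (m : nat) (A : 'M[R[i]]_m) i j :
  A \is normalmx -> `|A i j| <= real_complex R (schatten1 A).
Proof.
move=> /orthomx_spectralP; set P := spectralmx A; set d := spectral_diag A.
have Pu : P \is unitarymx by exact: spectral_unitarymx.
have P1 k l : `|P k l| <= 1.
  have /unitarymxP/matrixP/(_ k k) := Pu; rewrite !mxE eqxx mulr1n => /esym P1.
  rewrite -(@expr_le1 _ 2) // P1 (bigD1 l) //= !mxE -normCK lerDl.
  by apply: sumr_ge0 => q _; rewrite !mxE mul_conjC_ge0.
rewrite (invmx_unitary Pu) => AE; rewrite {1}AE mxE.
apply: le_trans (ler_norm_sum _ _ _) _.
rewrite /schatten1 rmorph_sum /=; apply: ler_sum => k _.
rewrite mul_mx_diag !mxE !normrM norm_conjC.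
rewrite -[X in _ <= X]mul1r -[X in _ <= X]mulr1.
by do 2![apply: ler_pM; rewrite ?mulr_ge0 //].
Qed.

Lemma psd_rank1 (C : numClosedFieldType) (m : nat) (x : 'cV[C]_m) :
  psdmx (x *m x ^t*).
Proof.
split=> [|v].
  apply/is_hermitianmxP; rewrite expr0 scale1r trmx_mul map_mxM.
  by congr (_ *m _); rewrite trmxCK.
have -> : v ^t* *m (x *m x ^t*) *m v = (v ^t* *m x) *m (v ^t* *m x) ^t*.
  by rewrite trmx_mul map_mxM trmxCK !mulmxA.
by rewrite mxE big_ord1 !mxE mul_conjC_ge0.
Qed.

Lemma psdD (C : numClosedFieldType) (m : nat) (M N : 'M[C]_m) :
  psdmx M -> psdmx N -> psdmx (M + N).
Proof.
move=> [/is_hermitianmxP + M0] [/is_hermitianmxP + N0].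
rewrite !expr0 !scale1r => MH NH; split=> [|v].
  by apply/is_hermitianmxP; rewrite expr0 scale1r linearD map_mxD -MH -NH.
by rewrite mulmxDr mulmxDl mxE addr_ge0.
Qed.

Lemma psdZ (C : numClosedFieldType) (m : nat) (c : C) (M : 'M[C]_m) :
  0 <= c -> psdmx M -> psdmx (c *: M).
Proof.
move=> c0 [/is_hermitianmxP + M0]; rewrite expr0 scale1r => MH; split=> [|v].
  apply/is_hermitianmxP; rewrite expr0 scale1r linearZ map_mxZ -MH.
  by congr (_ *: _); apply/esym/CrealP; rewrite ger0_real.
by rewrite -scalemxAr -scalemxAl mxE mulr_ge0.
Qed.

(** * The matrices rho *)

Section Rho.
Variable R : realType.
Local Notation u := (uvec R).
Local Notation ubar := (map_mx Num.conj u).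

Lemma uu_entries (i j : 'I_2) : (u *m u ^t*) i j =
  if i == j then 2^-1 else if i == 0 then - 'i / 2 else 'i / 2.
Proof.
have sE : (real_complex R (Num.sqrt 2))^-1 * (real_complex R (Num.sqrt 2))^-1
    = 2^-1.
  by rewrite -invfM -rmorphM -expr2 sqr_sqrtr ?ler0n // rmorph_nat.
have sC : ((real_complex R (Num.sqrt 2))^-1)^*
    = (real_complex R (Num.sqrt 2))^-1.
  by apply/CrealP; rewrite realV; apply/complex_realP; exists (Num.sqrt 2).
rewrite mxE big_ord1 !mxE rmorphM /= sC mulrACA sE mulrC complexiE.
case: (i =P j) => [<-|ij].
  case: (i == 0); first by rewrite rmorph1 mulr1 mul1r.
  by rewrite conjCi mulrN mulCii opprK mul1r.
move: i j ij; case=> [[|[|[]]] //= ?] [[|[|[]]] //= ?] ij.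
- by case: ij; exact: val_inj.
- by rewrite /= conjCi mul1r.
- by rewrite rmorph1 mulr1.
- by case: ij; exact: val_inj.
Qed.

Lemma uvec_trace : \tr (u *m u ^t*) = 1.
Proof.
rewrite /mxtrace !big_ord_recl big_ord0 !uu_entries !eqxx addr0.
by apply/esym; rewrite {1}(splitr 1) mul1r.
Qed.

Lemma ubar_projE : ubar *m ubar ^t* = map_mx Num.conj (u *m u ^t*).
Proof. by rewrite map_mxM map_trmx. Qed.

Lemma ubar_trace : \tr (ubar *m ubar ^t*) = 1.
Proof. by rewrite ubar_projE trace_map_mx uvec_trace; exact: rmorph1. Qed.

Lemma rhoE r :
  rho R r = 2^-1 *: (tensv r u *m (tensv r u) ^t*
                     + tensv r ubar *m (tensv r ubar) ^t*).
Proof.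
by rewrite /rho -scalerDr (tensmx_outer _ _ _ u) (tensmx_outer _ _ _ ubar).
Qed.

Lemma rho_entry r a b :
  rho R r a b = (tensmx r (u *m u ^t*) a b + (tensmx r (u *m u ^t*) a b)^*) / 2.
Proof.
rewrite rhoE tensmx_outer -map_tensv.
set x := tensv r u.
have -> : map_mx Num.conj x *m (map_mx Num.conj x) ^t*
    = map_mx Num.conj (x *m x ^t*) by rewrite map_mxM map_trmx.
move: (x *m x ^t*) => T.
by rewrite !mxE mulrC.
Qed.

Lemma rho_real r : rho R r \is a realmx.
Proof.
apply/mxOverP => a b; apply/CrealP; rewrite rho_entry.
by rewrite rmorphM rmorphD fmorphV rmorph_nat /= conjCK addrC.
Qed.

Lemma rho_trace r : \tr (rho R r) = 1.
Proof.
rewrite /rho; move: uvec_trace ubar_trace.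
(* Only the traces of the two projections matter. *)
move: (u *m u ^t*) (ubar *m ubar ^t*) => A B trA trB.
rewrite mxtrace_lin !mxtrace_tensmx trA trB expr1n.
by rewrite mulr1; apply/esym; rewrite {1}(splitr 1) mul1r.
Qed.

Lemma rho_psd r : psdmx (rho R r).
Proof.
rewrite rhoE; apply: psdZ; first by rewrite invr_ge0 ler0n.
by apply: psdD; exact: psd_rank1.
Qed.

Lemma rho_sym r : rho R r \is symmetricmx.
Proof.
have [/is_hermitianmxP + _] := rho_psd r; rewrite expr0 scale1r => rhoH.
apply/is_hermitianmxP; rewrite expr0 scale1r map_mx_id // [LHS]rhoH.
rewrite realmxC //; apply/mxOverP => a b; rewrite mxE.
exact: (mxOverP (rho_real r)).
Qed.

Lemma rho_doubly_symmetric r : doubly_symmetric (rho R r).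
Proof.
have rhoP : rho R r *m sym_proj R[i] 2 r = rho R r.
  have fixT v : (tensv r v) ^t* *m sym_proj R[i] 2 r = (tensv r v) ^t*.
    by rewrite /sym_proj proj_ortho_id // -map_trmx map_tensv tensv_sym.
  rewrite rhoE; move: (fixT u) (fixT ubar).
  move: (tensv r u) (tensv r ubar) (sym_proj _ _ _) => x y P xP yP.
  by rewrite -scalemxAl mulmxDl -!mulmxA xP yP.
have [/is_hermitianmxP + _] := rho_psd r; rewrite expr0 scale1r => rhoH.
split; [exact: rho_real | exact: rho_sym |].
rewrite -mulmxA rhoP -[X in X *m _]proj_ortho_herm [in LHS]rhoH.
by rewrite -map_mxM -trmx_mul rhoP -rhoH.
Qed.

Lemma partial_trace_rho d e : partial_trace (rho R (d + e)) = rho R d.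
Proof.
rewrite /rho; move: uvec_trace ubar_trace.
move: (u *m u ^t*) (ubar *m ubar ^t*) => A B trA trB.
by rewrite partial_trace_lin !partial_trace_tensmx trA trB expr1n !scale1r.
Qed.

End Rho.

(** * Separating rho 2 from the convex hull *)

Definition pair_index (i j : 'I_2) : 'I_(tdim 2 2) :=
  enum_rank [tuple i; j].

(** The two entries are exchanged by the partial transposition of the second
    factor, under which every v^{⊗2} (v^{⊗2})^T is invariant. *)
Definition gap (K : nzRingType) (M : 'M[K]_(tdim 2 2)) : K :=
  M (pair_index 0 1) (pair_index 1 0) - M (pair_index 0 0) (pair_index 1 1).

Arguments gap {K} M.

Lemma gap_lin (K : nzRingType) (a b : K) (M N : 'M[K]_(tdim 2 2)) :
  gap (a *: M + b *: N) = a * gap M + b * gap N.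
Proof. by rewrite /gap !mxE !mulrBr opprD addrACA. Qed.

Lemma gap_le (R : realType) (A : 'M[R[i]]_(tdim 2 2)) :
  A \is normalmx -> `|gap A| <= real_complex R (schatten1 A *+ 2).
Proof.
move=> An; rewrite rmorphMn mulr2n; apply: le_trans (ler_normB _ _) _.
by apply: lerD; exact: spectral_entry_le.
Qed.

Lemma gap_rho (R : realType) : gap (rho R 2) = 2^-1.
Proof.
rewrite /gap !rho_entry !mxE !enum_rankK.
rewrite !big_ord_recl !big_ord0 !(tnth_nth 0) /= !uu_entries /= !mulr1.
rewrite !(mulNr, mulrN, opprK).
have -> : ('i / 2) * ('i / 2) = - 4^-1 :> R[i].
  by rewrite mulrACA mulCii -invfM -natrM mulN1r.
rewrite !(opprK, rmorphN) fmorphV rmorph_nat.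
by field.
Qed.

Lemma tensv2E (K : comNzRingType) (v : 'cV[K]_2) i j :
  tensv 2 v (pair_index i j) 0 = v i 0 * v j 0.
Proof.
by rewrite mxE enum_rankK !big_ord_recl big_ord0 mulr1 !(tnth_nth 0).
Qed.

(** The symmetry of tau is recorded as well: it makes rho 2 - tau Hermitian,
    hence normal, as the bound on entries requires. *)
Lemma Cset_sym_gap (R : realType) (tau : 'M[R]_(tdim 2 2)) :
  tau \in Cset R 2 2 -> tau^T = tau /\ gap tau = 0.
Proof.
rewrite inE; pose S := [set M : 'M[R]_(tdim 2 2) | M^T = M /\ gap M = 0].
apply: (smallest_sub (X := S)).
  move=> M N t; rewrite !inE /= => -[MT M0] [NT N0].
  rewrite -[conv _ _ _]/(t%:num *: M + (1 - t%:num) *: N).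
  split; first by rewrite linearD !linearZ /= MT NT.
  by rewrite gap_lin M0 N0 !mulr0 addr0.
move=> _ [v _ <-] /=; split; first by rewrite trmx_mul trmxK.
rewrite /gap !mxE !big_ord1 [X in _ * X]mxE [X in _ - _ * X]mxE !tensv2E.
by rewrite mulrACA [v 1 0 * _]mulrC mulrACA subrr.
Qed.

Lemma rho2_far (R : realType) (t : 'M[R]_(tdim 2 2)) :
  t \in Cset R 2 2 -> 4^-1 <= schatten1 (rho R 2 - map_mx (real_complex R) t).
Proof.
move=> /Cset_sym_gap [tT t0]; set t' := map_mx _ t.
have MH : rho R 2 - t' \is hermsymmx.
  move: (rho R 2) (rho_real R 2) (rho_sym R 2) => M Mreal Msym.
  apply: realsym_hermsym.
    move/is_hermitianmxP: Msym; rewrite expr0 scale1r map_mx_id // => MT.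
    apply/is_hermitianmxP; rewrite expr0 scale1r map_mx_id //.
    by rewrite linearB /= -MT map_trmx tT.
  apply/mxOverP => a b; rewrite !mxE realB ?(mxOverP Mreal) //.
  by apply/complex_realP; exists (t a b).
have gapE : gap (rho R 2 - t') = 2^-1.
  rewrite -[rho R 2]scale1r -scaleN1r gap_lin gap_rho mul1r.
  have -> : gap t' = real_complex R (gap t) by rewrite /gap !mxE rmorphB.
  by rewrite t0 rmorph0 mulr0 addr0.
have := gap_le _ _ (hermitian_normalmx MH); rewrite gapE.
have -> : 2^-1 = real_complex R 2^-1 by rewrite fmorphV rmorph_nat.
rewrite ger0_norm ?lecR ?invr_ge0 ?ler0n //.
move: (schatten1 _) => s; lra.
Qed.

Theorem proposition4p1 (R : realType) :
  (forall r : nat, (2 <= r)%N ->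
     [/\ rho R r \is a realmx, doubly_symmetric (rho R r),
         psdmx (rho R r) & \tr (rho R r) = 1]) /\
  ~ exists tau : nat -> 'M[R]_(tdim 2 2),
      (forall r : nat, (2 <= r)%N -> tau r \in Cset R 2 2) /\
      (fun e : nat =>
         schatten1 (partial_trace (rho R (2 + e)%N)
                    - map_mx (real_complex R) (tau (2 + e)%N)))
        @ \oo --> (0 : R).
Proof.
split.
  move=> r _; split; [exact: rho_real | exact: rho_doubly_symmetric
    | exact: rho_psd | exact: rho_trace].
move=> [tau [tauC /cvgrPdist_lt/(_ 4^-1)]].
rewrite invr_gt0 ltr0n => /(_ isT) [e _ /(_ e (leqnn e))] /=.
have := rho2_far R _ (tauC (2 + e)%N isT).
rewrite partial_trace_rho sub0r normrN => far.
by rewrite ltNge (le_trans far (ler_norm _)).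
Qed.
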